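(* Let $M$ be a nonempty compact metric space and let $f : M \to M$ be a continuous map, with induced map $\widetilde{f} : \mathcal{M}(M) \to \mathcal{M}(M)$. The following assertions are equivalent: (i) $\widetilde{f}$ is chain continuous at some point of $\mathcal{M}(M)$; (ii) $\widetilde{f}$ is chain continuous at every point of $\mathcal{M}(M)$; (iii) $\bigcap_{n=1}^\infty f^n(M)$ is a singleton.
   Context: For a compact metric space $(M,d)$, $\mathcal{M}(M)$ is the space of Borel probability measures on $M$ with the Prohorov metric $d_P(\mu,\nu)=\inf\{\delta>0:\mu(X)\le\nu(X^\delta)+\delta \text{ and } \nu(X)\le\mu(X^\delta)+\delta \text{ for all Borel } X\subset M\}$, where $X^\delta=\{x\in M: d(x,X)<\delta\}$; it is a compact metric space. For a continuous map $f:M\to M$, the induced map $\widetilde f:\mathcal{M}(M)\to\mathcal{M}(M)$ is $(\widetilde f(\mu))(X)=\mu(f^{-1}(X))$ for Borel $X$. A self-map $g$ of a metric space with metric $\rho$ (open balls denoted $B(\cdot\,;\delta)$) is chain continuous at a point $x$ if for every $\varepsilon>0$ there exists $\delta>0$ such that for any choice of points $x_0\in B(x;\delta)$, $x_1\in B(g(x_0);\delta)$, $x_2\in B(g(x_1);\delta),\dots$, we have $\rho(x_n,g^n(x))<\varepsilon$ for all $n\ge 0$. *)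

(* Defs.v *)
From HB Require Import structures.
From mathcomp Require Import all_boot all_order all_algebra.
From mathcomp Require Import all_classical all_reals all_analysis.

Set Implicit Arguments.
Unset Strict Implicit.
Unset Printing Implicit Defensive.

Import Order.TTheory GRing.Theory Num.Theory.

Local Open Scope classical_set_scope.
Local Open Scope ring_scope.

(* Nonempty metric spaces.  A measurableType must be pointed, so nonemptiness
   is carried by a base point, which no definition below uses otherwise. *)
#[short(type="pmetricType")]
HB.structure Definition PointedMetric (R : numDomainType) :=
  {M of Pointed M & Metric R M}.

Notation borel M := (g_sigma_algebraType (@open M)).

Section induced_map.
Context {R : realType} {M : pmetricType R}.

(* The elements of [probability] are functions on all subsets of M.  Two of them
   that agree on the Borel sets denote the same point of M(M), but need not be
   equal; the definitions below only depend on the values on Borel sets. *)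
Definition borel_probability := probability (borel M) R.

(* [edist] is defined from balls; on a metric space it is the distance. *)
Lemma edist_mdist (x y : M) : edist (x, y) = (mdist x y)%:E.
Proof.
apply/eqP; rewrite eq_le; apply/andP; split.
  apply/lee_addgt0Pr => e e0; apply: ereal_inf_lbound.
  exists (mdist x y + e) => //; split; first by rewrite ltr_wpDl ?mdist_ge0.
  by rewrite ballEmdist/= ltrDl.
apply: le_ereal_inf_tmp => _ [r [r0 +] <-].
by rewrite ballEmdist/= lee_fin => /ltW.
Qed.

(* [edist_inf set0] is constantly +oo, so the thickening of set0 is empty. *)
Definition thickening (X : set M) (delta : R) : set M :=
  [set x | (edist_inf X x < delta%:E)%E].

Definition prohorov (mu nu : borel_probability) : R :=
  inf [set delta : R | 0 < delta /\
    forall X : set (borel M), measurable X ->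
      (mu X <= nu (thickening X delta) + delta%:E)%E /\
      (nu X <= mu (thickening X delta) + delta%:E)%E].

Lemma continuous_borel_measurable (f : M -> M) : continuous f ->
  measurable_fun [set: borel M] (f : borel M -> borel M).
Proof.
move=> /continuousP cf.
apply: (@measurability _ _ (borel M) (borel M) setT f (@open M)) => //.
move=> _ [B oB <-]; rewrite setTI.
by apply: sub_sigma_algebra; exact: cf.
Qed.

Definition borel_mfun (f : M -> M) (cf : continuous f) :
    {mfun borel M >-> borel M} :=
  mfun_Sub (mem_set (continuous_borel_measurable cf)).

Definition induced_map (f : M -> M) (cf : continuous f)
    (mu : borel_probability) : borel_probability :=
  distribution mu (borel_mfun cf).

Lemma induced_mapE (f : M -> M) (cf : continuous f) mu (X : set M) :
  induced_map cf mu X = mu (f @^-1` X).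
Proof. by []. Qed.

End induced_map.
Arguments borel_probability {R} M.

Definition chain_continuous {R : realType} {T : Type} (rho : T -> T -> R)
    (g : T -> T) (x : T) :=
  forall eps : R, 0 < eps -> exists2 delta : R, 0 < delta &
    forall u : nat -> T,
      rho x (u 0%N) < delta ->
      (forall n, rho (g (u n)) (u n.+1) < delta) ->
      forall n, rho (u n) (iter n g x) < eps.

(* Main.v *)
(* All three assertions amount to diam f^N(M) -> 0.  If the induced map F is
   chain continuous at mu, fix t > 0 small; for each x, the measures
   (1 - t)^n F^n(mu) + (1 - (1 - t)^n) delta_(f^n x) form a chain from mu, so
   they stay close to F^n(mu).  Hence, for some N independent of x, F^N(mu)
   gives mass > 1/2 to a small ball around f^N x; for any x and y these two
   balls meet.  Conversely, if f^N(M) is small then so is F^N(M(M)), and a fine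
   chain is determined, up to epsilon, by its last N steps, because F is
   uniformly continuous. *)
From HB Require Import structures.
Require Import Defs.
From mathcomp Require Import all_boot all_order all_algebra.
From mathcomp Require Import all_classical all_reals all_analysis.
From mathcomp Require Import ring lra.

Set Implicit Arguments.
Unset Strict Implicit.

Import Order.TTheory GRing.Theory Num.Theory.
Import numFieldNormedType.Exports.

Local Open Scope classical_set_scope.
Local Open Scope ring_scope.

(** * Values and convex combinations of probability measures *)

Lemma probability_fin d (T : measurableType d) (R : realType)
    (P : probability T R) (X : set T) : measurable X ->
  exists r : R, [/\ 0 <= r, r <= 1 & P X = r%:E].
Proof.
move=> mX; have PX : P X \is a fin_num by apply: fin_num_measure.
exists (fine (P X)); rewrite fineK// fine_ge0//; split=> //.
by rewrite -lee_fin fineK// probability_le1.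
Qed.

Lemma convex_combination_probability d (T : measurableType d) (R : realType)
    (mu nu : probability T R) (a : R) : 0 <= a -> a <= 1 ->
  exists p : probability T R,
    forall X, p X = ((1 - a)%:E * mu X + a%:E * nu X)%E.
Proof.
move=> a0 a1; have b0 : 0 <= 1 - a by rewrite subr_ge0.
pose m : {measure set T -> \bar R} :=
  measure_add (mscale (NngNum b0) mu) (mscale (NngNum a0) nu).
have mE X : m X = ((1 - a)%:E * mu X + a%:E * nu X)%E.
  exact: measure_addE.
have m1 : m setT = 1%E.
  by rewrite mE !probability_setT !mule1 -EFinD subrK.
pose B := Measure_isProbability.Build _ _ _ m m1.
pose P : probability T R := HB.pack (Measure.sort m) B.
by exists P.
Qed.

(** * Thickenings and the Prohorov metric *)

Section prohorov.
Context {R : realType} {M : pmetricType R}.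
Implicit Types (mu nu : borel_probability M) (X : set M).

Lemma thickeningE X (d : R) :
  thickening X d = [set x | exists2 y, X y & mdist x y < d].
Proof.
apply/seteqP; split=> x.
  by move=> /ereal_inf_lt[_ [y Xy <-]]; rewrite edist_mdist lte_fin; exists y.
move=> [y Xy xy]; apply: (@le_lt_trans _ _ (edist (x, y))).
  by apply: ereal_inf_lbound; exists y.
by rewrite edist_mdist lte_fin.
Qed.

(** A thickening is a union of open balls centred in [X], so it is Borel even when [X] is not. *)
Lemma open_thickening X (d : R) : open (thickening X d).
Proof.
have -> : thickening X d = \bigcup_(y in X) [set x | mdist y x < d].
  rewrite thickeningE; apply/seteqP; split=> x [y Xy xy]; exists y => //=.
    by rewrite metric_sym.
  by rewrite metric_sym.
apply: bigcup_open => y Xy; rewrite openE => x /= yx.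
apply/nbhs_ballP; exists (d - mdist y x) => /=; first by rewrite subr_gt0.
move=> z; rewrite ballEmdist /= => xz.
by rewrite (le_lt_trans (metric_triangle y x z))// -ltrBrDl.
Qed.

Lemma open_borel_measurable X : open X -> measurable (X : set (borel M)).
Proof. exact: sub_sigma_algebra. Qed.

Lemma measurable_thickening X (d : R) :
  measurable (thickening X d : set (borel M)).
Proof. by apply: open_borel_measurable; exact: open_thickening. Qed.
Hint Resolve measurable_thickening : core.

Lemma set1_borel_measurable (x : M) : measurable ([set x] : set (borel M)).
Proof.
rewrite -[X in measurable X]setCK; apply: measurableC.
apply: open_borel_measurable; apply: closed_openC.
apply: compact_closed; [exact: metric_hausdorff|exact: compact_set1].
Qed.

Lemma subset_thickening X (d : R) : 0 < d -> X `<=` thickening X d.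
Proof. by move=> d0 x Xx; rewrite thickeningE; exists x; rewrite ?mdistxx. Qed.

Definition prohorov_close mu nu (d : R) :=
  forall X : set (borel M), measurable X ->
    (mu X <= nu (thickening X d) + d%:E)%E /\
    (nu X <= mu (thickening X d) + d%:E)%E.

Lemma prohorov_lt mu nu (d e : R) :
  0 < d -> d < e -> prohorov_close mu nu d -> prohorov mu nu < e.
Proof.
move=> d0 de c; apply: le_lt_trans de; apply: ge_inf => //.
by exists 0 => r [/ltW].
Qed.

Lemma prohorov_ltP mu nu (e : R) : prohorov mu nu < e ->
  exists d : R, [/\ 0 < d, d < e & prohorov_close mu nu d].
Proof.
move=> /inf_lt[|d [d0 c] de]; last by exists d.
(* The infimum is over a nonempty set: 1 always qualifies, because masses are at most 1. *)
exists 1; split=> // X mX.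
by split; apply: le_trans (probability_le1 _ mX) _; rewrite leeDr.
Qed.

(** Uniform closeness on Borel sets is stronger than Prohorov closeness, since [X] lies in its own
    thickening. *)
Lemma prohorov_lt_sup mu nu (d e : R) : 0 < d -> d < e ->
  (forall X : set (borel M), measurable X ->
    (mu X <= nu X + d%:E)%E /\ (nu X <= mu X + d%:E)%E) ->
  prohorov mu nu < e.
Proof.
move=> d0 de c; apply: (prohorov_lt d0 de) => X mX.
have [h1 h2] := c X mX.
split; [apply: le_trans h1 _|apply: le_trans h2 _]; apply: leeD => //;
  by apply: le_measure; rewrite ?inE//; exact: subset_thickening.
Qed.

Lemma prohorov_refl mu (e : R) : 0 < e -> prohorov mu mu < e.
Proof.
move=> e0; apply: (@prohorov_lt_sup _ _ (e / 2)); [lra|lra|].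
by move=> X mX; rewrite leeDl// lee_fin; lra.
Qed.

Lemma prohorov_sym mu nu : prohorov mu nu = prohorov nu mu.
Proof.
by congr inf; apply/seteqP; split=> d [d0 c]; split=> // X /c[].
Qed.

Lemma prohorov_triangle mu nu la (a b : R) :
  prohorov mu nu < a -> prohorov nu la < b -> prohorov mu la < a + b.
Proof.
move=> /prohorov_ltP[c [c0 ca h1]] /prohorov_ltP[d [d0 db h2]].
apply: (@prohorov_lt _ _ (c + d)); [lra|lra|] => X mX.
have sub c' d' :
    thickening (thickening X c') d' `<=` thickening X (c' + d').
  rewrite !thickeningE => x [y [z Xz yz] xy]; exists z => //.
  by rewrite (le_lt_trans (metric_triangle x y z))//; lra.
have le3 (p q r : borel_probability M) c' d' :
    (p X <= q (thickening X c') + c'%:E)%E ->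
    (q (thickening X c') <= r (thickening (thickening X c') d') + d'%:E)%E ->
    (p X <= r (thickening X (c' + d')%R) + (c' + d')%:E)%E.
  move=> pq qr; apply: le_trans pq _.
  rewrite [(c' + d')%R in leRHS]addrC EFinD addeA leeD2r//.
  apply: le_trans qr _; rewrite leeD2r//.
  by apply: le_measure; rewrite ?inE// addrC; exact: sub.
split; first by apply: (le3 mu nu la); [exact: (h1 _ mX).1|exact: (h2 _ _).1].
(* In this direction the set is thickened by [d] first and then by [c]. *)
rewrite (addrC c).
by apply: (le3 la nu mu); [exact: (h2 _ mX).2|exact: (h1 _ _).2].
Qed.

End prohorov.

(** * Iterates of a continuous map on a compact metric space *)

Section compact_dynamics.
Context {R : realType} {M : pmetricType R} (compactM : compact [set: M]).
Context (f : M -> M) (cf : continuous f).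

Lemma mdist_half (y x z : M) (e : R) :
  mdist x y < e / 2 -> mdist y z < e / 2 -> mdist x z < e.
Proof.
move=> xy yz; rewrite (splitr e).
exact: le_lt_trans (metric_triangle x y z) (ltrD xy yz).
Qed.

Lemma compact_unif_continuous (e : R) : 0 < e ->
  exists2 d : R, 0 < d & forall x y, mdist x y < d -> mdist (f x) (f y) < e.
Proof.
move=> e0.
pose P (d : R) x := forall y, mdist x y < d -> mdist (f x) (f y) < e.
have cov : \forall d \near 0^'+, [set: M] `<=` P d.
  apply: (compact_near_coveringP _).1 compactM _ _ _ _ _ => x _.
  have e20 : 0 < e / 2 by rewrite divr_gt0.
  have /nbhs_ballP[r /= r0 br] : nbhs x (f @^-1` ball (f x) (e / 2)).
    by apply: cf; exact: nbhsx_ballx.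
  have r20 : 0 < r / 2 by rewrite divr_gt0.
  (* With both radii halved, a point within [d] of [z] stays within [r] of [x], so [f x] can be
     compared with both images. *)
  exists (ball x (r / 2), [set d | d < r / 2]) => /=.
    by split; [exact: nbhsx_ballx|exact: nbhs_right_lt].
  move=> [z d] /= [+ dr] y zy; rewrite ballEmdist /= => xz.
  have fball t : mdist x t < r -> mdist (f x) (f t) < e / 2.
    by have := br t; rewrite !ballEmdist.
  apply: (@mdist_half (f x)).
    rewrite metric_sym; apply: fball; apply: lt_trans xz _.
    by rewrite gtr_pMr// invf_lt1// ltr1n.
  by apply: fball; apply: (@mdist_half z) => //; exact: lt_trans dr.
have [d /= [d0 Pd]] : exists d : R, 0 < d /\ [set: M] `<=` P d.
  have : \forall d \near (0:R)^'+, 0 < d /\ [set: M] `<=` P d.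
    by apply: filterI => //; exact: nbhs_right_gt.
  exact: filter_ex.
by exists d => // x; exact: Pd.
Qed.

Lemma continuous_iter n : continuous (iter n f).
Proof.
elim: n => [|n IHn] x /=; first exact: cvg_id.
by apply: (@continuous_comp _ _ _ (iter n f) f); [exact: IHn|exact: cf].
Qed.

Lemma range_iter_decr m n : (m <= n)%N ->
  range (iter n f) `<=` range (iter m f).
Proof.
by move=> mn _ [x _ <-]; exists (iter (n - m) f x); rewrite -?iterD ?subnKC.
Qed.

Lemma closed_range_iter n : closed (range (iter n f)).
Proof.
apply: compact_closed; first exact: metric_hausdorff.
apply: continuous_compact => //; apply: continuous_subspaceT.
exact: continuous_iter.
Qed.

(** Any cluster point of an orbit works: the orbit eventually enters each range, and the ranges are
    closed. *)
Lemma bigcap_range_iter_nonempty :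
  \bigcap_(n in [set n : nat | (1 <= n)%N]) range (iter n f) !=set0.
Proof.
have [p [_ clp]] := @compactM (iter n f point @[n --> \oo]) _ filterT.
exists p => n _; apply: closed_range_iter => B nB.
have [|q [q1 q2]] := clp (range (iter n f)) B _ nB; last by exists q.
by exists n => // m nm; apply: (range_iter_decr nm); exists point.
Qed.

(** As the ranges of the iterates are nested, this says that their diameters tend to 0. *)
Definition shrinking :=
  forall e : R, 0 < e ->
    exists N, forall x y, mdist (iter N f x) (iter N f y) < e.

(** Forwards, two points of the intersection lie in every range, hence coincide. Backwards, each
    point other than [x] has a neighborhood missing some closed range and all later ones;
    compactness makes the index uniform. *)
Lemma shrinkingP : shrinking <->
  exists x, \bigcap_(n in [set n : nat | (1 <= n)%N]) range (iter n f) = [set x].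
Proof.
split=> [sh|[x capx] e e0].
  have [p capp] := bigcap_range_iter_nonempty; exists p.
  apply/seteqP; split=> [q capq|_ ->//].
  apply/eqP; rewrite -(negbK (q == p)) -mdist_gt0; apply/negP => /sh[N].
  (* The intersection starts at index 1, so [N.+1] is used to cover [N] = 0; the extra [f] goes into
     the arguments. *)
  have [y _ <-] := capq N.+1 isT; have [z _ <-] := capp N.+1 isT.
  by move=> /(_ (f y) (f z)); rewrite -!iterSr ltxx.
(* Vacuous for [y] outside the range, so an [n] valid for all [y] puts the whole range near [x]. *)
pose P n y := range (iter n f) y -> mdist x y < e / 2.
have e20 : 0 < e / 2 by rewrite divr_gt0.
have [N _ /(_ N (leqnn _)) PN] : \forall n \near \oo, [set: M] `<=` P n.
  apply: (compact_near_coveringP _).1 compactM _ _ _ _ _ => y _.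
  have [->|yx] := eqVneq y x.
    exists (ball x (e / 2), setT) => /=.
      by split; [exact: nbhsx_ballx|exact: filterT].
    by move=> [z n] /= [+ _] _; rewrite ballEmdist.
  have [n ny] : exists n, ~ range (iter n f) y.
    apply: contrapT => /forallNP h; move/eqP: yx; apply.
    suff : [set x] y by [].
    by rewrite -capx => n _; exact: contrapT.
  exists (~` range (iter n f), [set m | (n <= m)%N]) => /=.
    split; last by exists n.
    by apply: open_nbhs_nbhs; split=> //; exact/closed_openC/closed_range_iter.
  by move=> [z m] /= [nz nm] /(range_iter_decr nm).
exists N => y z.
have ry := PN (iter N f y) I (imageP _ I).
have rz := PN (iter N f z) I (imageP _ I).
by apply: (@mdist_half x); [rewrite metric_sym|].
Qed.

End compact_dynamics.

(** * Dynamics of the induced map on measures *)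

Section induced_dynamics.
Context {R : realType} {M : pmetricType R} (compactM : compact [set: M]).
Context (f : M -> M) (cf : continuous f).
Implicit Types (mu nu : borel_probability M).

Local Notation F := (@induced_map R M f cf).

Lemma iter_induced_mapE n mu (X : set M) :
  iter n F mu X = mu (iter n f @^-1` X).
Proof. by elim: n X => [//|n IHn] X /=; rewrite induced_mapE IHn. Qed.

(** Uniform continuity of [f] puts a thin thickening of the preimage of [X] inside the preimage of a
    thickening of [X]. *)
Lemma induced_map_unif_continuous (e : R) : 0 < e ->
  exists2 d : R, 0 < d &
    forall mu nu, prohorov mu nu < d -> prohorov (F mu) (F nu) < e.
Proof.
move=> e0; have [|d d0 fd] := compact_unif_continuous compactM cf (e := e / 2).
  by rewrite divr_gt0.
exists (Num.min d (e / 2)); first by rewrite lt_min d0 divr_gt0.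
move=> mu nu /prohorov_ltP[c [c0 + cl]]; rewrite lt_min => /andP[cd ce].
apply: (@prohorov_lt _ _ _ _ (e / 2)); [lra|lra|] => X mX.
have mfX : measurable (f @^-1` X : set (borel M)).
  by rewrite -[f @^-1` X]setTI; exact: continuous_borel_measurable.
have sub : thickening (f @^-1` X) c `<=` f @^-1` thickening X (e / 2).
  rewrite !thickeningE => x [y Xy xy]; exists (f y) => //.
  by apply: fd; exact: lt_trans cd.
have le (p q : borel_probability M) :
    (p (f @^-1` X) <= q (thickening (f @^-1` X) c) + c%:E)%E ->
    (F p X <= F q (thickening X (e / 2)) + (e / 2)%:E)%E.
  move=> pq; rewrite [leLHS]induced_mapE [F q _]induced_mapE.
  apply: le_trans pq _; apply: leeD.
    apply: le_measure; rewrite ?inE//; first exact: measurable_thickening.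
    rewrite -[X in measurable X]setTI; apply: continuous_borel_measurable => //.
    exact: measurable_thickening.
  by rewrite lee_fin ltW.
by have [h1 h2] := cl _ mfX; split; exact: le.
Qed.

(** Here [d] depends on [n] but not on [mu], so that a chain can later be restarted at any of its
    points. *)
Lemma chain_shadow_iter n (e : R) : 0 < e ->
  exists2 d : R, 0 < d & forall mu (u : nat -> borel_probability M),
    prohorov mu (u 0%N) < d ->
    (forall k, prohorov (F (u k)) (u k.+1) < d) ->
    prohorov (u n) (iter n F mu) < e.
Proof.
elim: n e => [|n IHn] e e0.
  by exists e => // mu u; rewrite prohorov_sym.
have e20 : 0 < e / 2 by rewrite divr_gt0.
have [a a0 Fa] := induced_map_unif_continuous e20.
have [b b0 ub] := IHn _ a0.
exists (Num.min b (e / 2)); first by rewrite lt_min b0.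
move=> mu u; rewrite lt_min => /andP[u0 _] uS.
rewrite (splitr e); apply: (@prohorov_triangle _ _ _ (F (u n))).
  by rewrite prohorov_sym; have := uS n; rewrite lt_min => /andP[].
apply: Fa; apply: ub => // k.
by have := uS k; rewrite lt_min => /andP[].
Qed.

Lemma chain_shadow_iter_le N (e : R) : 0 < e ->
  exists2 d : R, 0 < d & forall n, (n <= N)%N ->
    forall mu (u : nat -> borel_probability M),
    prohorov mu (u 0%N) < d ->
    (forall k, prohorov (F (u k)) (u k.+1) < d) ->
    prohorov (u n) (iter n F mu) < e.
Proof.
move=> e0; elim: N => [|N [a a0 IHN]].
  have [d d0 h] := chain_shadow_iter 0 e0; exists d => // n.
  by rewrite leqn0 => /eqP ->.
have [b b0 h] := chain_shadow_iter N.+1 e0.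
exists (Num.min a b); first by rewrite lt_min a0.
move=> n; rewrite leq_eqVlt ltnS => nN mu u.
rewrite lt_min => /andP[ua ub] uS.
case/orP: nN => [/eqP ->|nN]; [apply: h|apply: IHN] => // k;
  by have := uS k; rewrite lt_min => /andP[].
Qed.

(** If [X] meets the range of one iterate, its thickening contains the range of the other and has
    mass 1; otherwise [X] has mass 0. *)
Lemma prohorov_iter_lt N m n (d e : R) mu nu :
  (forall x y, mdist (iter N f x) (iter N f y) < d) ->
  0 < d -> d < e -> (N <= m)%N -> (N <= n)%N ->
  prohorov (iter m F mu) (iter n F nu) < e.
Proof.
move=> fd d0 de Nm Nn; apply: (prohorov_lt d0 de) => X mX.
have le i j (p q : borel_probability M) : (N <= i)%N -> (N <= j)%N ->
    (iter i F p X <= iter j F q (thickening X d) + d%:E)%E.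
  move=> Ni Nj.
  have [[x Xx]|noX] := pselect (exists x, X (iter i f x)).
    apply: le_trans (probability_le1 _ mX) _.
    rewrite (iter_induced_mapE j).
    suff -> : iter j f @^-1` thickening X d = setT.
      by rewrite probability_setT leeDl// lee_fin ltW.
    apply/seteqP; split=> // y _; rewrite thickeningE.
    exists (iter i f x) => //.
    by rewrite -(subnKC Ni) -(subnKC Nj) !iterD.
  rewrite iter_induced_mapE; have -> : iter i f @^-1` X = set0.
    by rewrite -subset0 => x Xx; apply: noX; exists x.
  by rewrite measure0 adde_ge0// lee_fin ltW.
by split; exact: le.
Qed.

Lemma shrinking_chain_continuous : shrinking f ->
  forall mu, chain_continuous (@prohorov R M) F mu.
Proof.
move=> sh mu e e0.
have e20 : 0 < e / 2 by rewrite divr_gt0.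
have e40 : 0 < e / 2 / 2 by rewrite !divr_gt0.
have [N fN] := sh _ e40.
have [d d0 ud] := chain_shadow_iter_le N e20.
exists d => // u u0 uS n.
have [nN|/ltnW Nn] := leqP n N.
  by apply: lt_trans (ud n nN _ _ u0 uS) _; rewrite gtr_pMr// invf_lt1// ltr1n.
(* Only the last [N] steps matter: the chain restarted at time [n - N] shadows a true orbit, whose
   endpoint and [iter n F mu] are close by shrinking. *)
rewrite (splitr e); apply: (@prohorov_triangle _ _ _ (iter N F (u (n - N)%N))).
  have := ud N (leqnn N) (u (n - N)%N) (fun k => u (n - N + k)%N).
  rewrite subnK//; apply; first by rewrite addn0; exact: prohorov_refl.
  by move=> k; rewrite addnS.
apply: (prohorov_iter_lt _ _ fN) => //; lra.
Qed.

(* The chain drifts from the orbit of [mu] to that of the Dirac measure at [x],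
   by moving a fraction [t] of the remaining mass at every step. *)
Lemma drifting_chain mu (x : M) (t : R) : 0 < t -> t < 1 ->
  exists u : nat -> borel_probability M,
    [/\ forall e, 0 < e -> prohorov mu (u 0%N) < e,
        forall n e, t < e -> prohorov (F (u n)) (u n.+1) < e &
        forall n, ((1 - (1 - t) ^+ n)%:E <= u n [set iter n f x])%E].
Proof.
move=> t0 t1.
pose s n := 1 - (1 - t) ^+ n.
have s0 n : 0 <= s n by rewrite subr_ge0 exprn_ile1//; lra.
have s1 n : s n <= 1 by rewrite gerBl exprn_ge0//; lra.
pose D n : borel_probability M := \d_(iter n f x : borel M).
have ex n : exists p : borel_probability M,
    forall X, p X = ((1 - s n)%:E * iter n F mu X + (s n)%:E * D n X)%E.
  exact: convex_combination_probability.
have [u uE] := choice ex.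
exists u; split.
- move=> e e0.
  apply: (@prohorov_lt_sup _ _ _ _ (e / 2)); [lra|lra|] => X mX.
  rewrite uE /s expr0 subrr subr0 mul1e mul0e adde0.
  by rewrite leeDl// lee_fin; lra.
- move=> n e te; apply: (prohorov_lt_sup t0 te) => X mX.
  rewrite [F (u n) X]induced_mapE !uE.
  have -> : D n (f @^-1` X) = D n.+1 X by [].
  have -> : iter n F mu (f @^-1` X) = iter n.+1 F mu X by [].
  have [a [a0 a1 ->]] := probability_fin (iter n.+1 F mu) mX.
  have [b [b0 b1 ->]] := probability_fin (D n.+1) mX.
  (* The two masses differ by [t * (1 - s n) * (b - a)], which is at most [t] in absolute value. *)
  have sS : s n.+1 = s n + t * (1 - s n) by rewrite /s exprS; ring.
  rewrite -!EFinM -!EFinD !lee_fin sS.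
  have [h0 h1] := (s0 n, s1 n).
  have c0 : 0 <= t * (1 - s n) by apply: mulr_ge0; lra.
  have c1 : t * (1 - s n) <= t by rewrite ler_piMr; lra.
  set c := t * (1 - s n) in c0 c1 *.
  split; nra.
- move=> n; rewrite uE /D.
  have -> : (\d_(iter n f x : borel M) : borel_probability M) [set iter n f x] = 1%E.
    by rewrite /= diracE mem_set.
  by rewrite mule1 leeDr// mule_ge0// lee_fin subr_ge0.
Qed.

Lemma chain_continuous_shrinking mu :
  chain_continuous (@prohorov R M) F mu -> shrinking f.
Proof.
move=> ch e e0.
(* The bound [e / 2] controls the radius of the balls; 1/4 leaves them mass above 3/4 - 1/4. *)
pose e' := Num.min (e / 2) 4^-1.
have e'0 : 0 < e' by rewrite lt_min divr_gt0// invr_gt0 ltr0n.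
have [d d0 ud] := ch e' e'0.
pose t := Num.min (d / 2) 2^-1.
have t0 : 0 < t by rewrite lt_min divr_gt0// invr_gt0 ltr0n.
have t1 : t < 1 by rewrite gt_min invf_lt1// ltr1n orbT.
have td : t < d by rewrite gt_min gtr_pMr// invf_lt1// ltr1n.
(* [N] depends on [t] alone, hence serves all points [x] and [y]. *)
have [N tN] : exists N, (1 - t) ^+ N < 4^-1.
  have c : (1 - t) ^+ n @[n --> \oo] --> (0 : R).
    by apply: cvg_expr; rewrite ger0_norm; lra.
  have q0 : 0 < 4^-1 :> R by rewrite invr_gt0 ltr0n.
  have [N _ /(_ N (leqnn N)) hN] := cvgr_lt _ c _ q0.
  by exists N.
exists N => x y.
pose nu := iter N F mu.
pose B z : set (borel M) := thickening [set iter N f z] (e / 2).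
have mB z : measurable (B z) by exact: measurable_thickening.
have nuB z : (2^-1%:E < nu (B z))%E.
  have [u [u0 uS uN]] := drifting_chain mu z t0 t1.
  have := ud u (u0 _ d0) (fun n => uS n _ td) N.
  move=> /prohorov_ltP[c [c0 + cl]]; rewrite lt_min => /andP[ce c4].
  have [h _] := cl _ (set1_borel_measurable (iter N f z)).
  have : (nu (thickening [set iter N f z] c) <= nu (B z))%E.
    apply: le_measure; rewrite ?inE//; first exact: measurable_thickening.
    rewrite /B !thickeningE => w [v -> wv]; exists (iter N f z) => //.
    exact: lt_trans ce.
  have := le_trans (uN N) h.
  have [a [_ _ ->]] := probability_fin nu (mB z).
  have [b [_ _ ->]] :=
    probability_fin nu (measurable_thickening [set iter N f z] c).
  rewrite -EFinD !lee_fin lte_fin; lra.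
have [[w [Bx By]]|disj] := pselect (B x `&` B y !=set0).
  move: Bx By; rewrite /B !thickeningE => -[_ -> wx] [_ -> wy].
  by apply: (@mdist_half _ _ w) => //; rewrite metric_sym.
(* Disjoint balls, each of mass above 1/2, would have total mass above 1. *)
have B0 : B x `&` B y = set0 by apply: contrapT => /eqP/set0P.
have [a [_ _ aE]] := probability_fin nu (mB x).
have [b [_ _ bE]] := probability_fin nu (mB y).
have ab1 : (a%:E + b%:E <= 1)%E.
  rewrite -aE -bE; apply: (@le_trans _ _ (nu (B x `|` B y))).
    by rewrite measureU.
  exact: probability_le1 (measurableU _ _ (mB x) (mB y)).
have := nuB x; have := nuB y; rewrite aE bE !lte_fin.
move: ab1; rewrite -EFinD lee_fin; lra.
Qed.

End induced_dynamics.

Unset Implicit Arguments.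
Set Strict Implicit.

Theorem theorem10 (R : realType) (M : pmetricType R)
    (compactM : compact [set: M]) (f : M -> M) (cf : continuous f) :
  [<-> (exists mu : borel_probability M,
          chain_continuous (@prohorov R M) (induced_map cf) mu);
       (forall mu : borel_probability M,
          chain_continuous (@prohorov R M) (induced_map cf) mu);
       (exists x : M,
          \bigcap_(n in [set n : nat | (1 <= n)%N])
            (iter n f @` [set: M]) = [set x])].
Proof.
tfae.
- move=> [mu /chain_continuous_shrinking].
  exact: shrinking_chain_continuous.
- move=> ch; apply/(shrinkingP compactM cf).
  (* Any measure would do; the Dirac mass at the base point shows that there is one. *)
  exact: (chain_continuous_shrinking (ch (\d_(point : borel M) : borel_probability M))).
- move=> /(shrinkingP compactM cf) sh.
  by exists (\d_(point : borel M) : borel_probability M); exact: shrinking_chain_continuous.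
Qed.
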